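(* Let $m,n\ge1$. Then $\mathbb{M}_{m,1}^n$ is a module over the quiver $\mathbb{Y}_m^{op}\times\mathbb{Y}_n^{op}\times\mathbb{Y}_{m+n-1}$ with all commuting relations; that is, for any two paths with the same start and the same end in this quiver, the associated compositions of linear maps of $\mathbb{M}_{m,1}^n$ are equal.
   Context: **Trees and Tamari order.** A planar binary tree is either a dot $\circ$ or a pair $(x\,y)$ of planar binary trees; its degree is its number of dots minus one; $\mathbb{Y}_n$ is the set of planar binary trees of degree $n\ge1$; $Y=(\circ\,\circ)$. The Tamari order on $\mathbb{Y}_n$: $x\le y$ if $x$ is obtained from $y$ by a sequence of local changes replacing a subtree $(a(bc))$ by $((ab)c)$, with $a,b,c$ planar binary trees, possibly dots. $\mathbb{Y}_n$ is also regarded as a quiver: the Hasse diagram with edges oriented decreasingly (from the larger to the smaller element). **Dendriform operad.** $\mathrm{Dend}(n)=\mathbb{Z}\mathbb{Y}_n$, and the composition $\circ_i:\mathrm{Dend}(m)\otimes\mathrm{Dend}(n)\to\mathrm{Dend}(m+n-1)$, $1\le i\le m$, is that of the dendriform (nonsymmetric) operad: a dendriform algebra has two bilinear operations $\prec,\succ$ with $(a\prec b)\prec c=a\prec(b\prec c+b\succ c)$, $(a\succ b)\prec c=a\succ(b\prec c)$, $(a\prec b+a\succ b)\succ c=a\succ(b\succ c)$. Each tree $x\in\mathbb{Y}_m$ gives an $m$-ary operation on dendriform algebras: $Y(a)=a$, and for $x=(l\,r)$ with $l$ of degree $k-1$, $x(a_1,\dots,a_m)=l(a_1,\dots,a_{k-1})\succ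 a_k\prec r(a_{k+1},\dots,a_m)$, omitting factors for which $l$ or $r$ is a dot. Then $x\circ_i y$ is the unique element of $\mathrm{Dend}(m+n-1)$ whose associated operation is $x(a_1,\dots,a_{i-1},y(a_i,\dots,a_{i+n-1}),a_{i+n},\dots,a_{m+n-1})$. **Projective elements.** $\mathscr{P}(x)=\sum_{y\le x}y\in\mathrm{Dend}(n)$ for $x\in\mathbb{Y}_n$. **The module.** Let $\mathcal{M}_{m,1}^n=\{(x,y,z)\in\mathbb{Y}_m\times\mathbb{Y}_n\times\mathbb{Y}_{m+n-1}\mid z\in\mathscr{P}(x)\circ_1\mathscr{P}(y)\}$, where $z\in\mathscr{P}(x)\circ_1\mathscr{P}(y)$ means that $z$ occurs in this sum of planar binary trees. The quiver $\mathbb{Y}_m^{op}\times\mathbb{Y}_n^{op}\times\mathbb{Y}_{m+n-1}$ has vertex set $\mathbb{Y}_m\times\mathbb{Y}_n\times\mathbb{Y}_{m+n-1}$ and arrows changing exactly one coordinate along an arrow of $\mathbb{Y}_m^{op}$, $\mathbb{Y}_n^{op}$ or $\mathbb{Y}_{m+n-1}$ respectively ($op$ means reversed arrows). $\mathbb{M}_{m,1}^n$ is given by placing $\mathbb{Q}$ at each element of $\mathcal{M}_{m,1}^n$ and $0$ at all other vertices, and by letting each arrow act as the identity of $\mathbb{Q}$ if both its source and target are in $\mathcal{M}_{m,1}^n$, and as $0$ otherwise. *)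

(* Defs.v *)
From HB Require Import structures.
From mathcomp Require Import all_boot all_order all_algebra.
From mathcomp Require Import classical_sets.

Set Implicit Arguments.
Unset Strict Implicit.
Unset Printing Implicit Defensive.

Import GRing.Theory.
Local Open Scope ring_scope.

(** * Planar binary trees *)

Inductive tree := Circ | Node (l r : tree).

Fixpoint tree_encode (x : tree) : GenTree.tree unit :=
  if x is Node l r then GenTree.Node 0 [:: tree_encode l; tree_encode r]
  else GenTree.Leaf tt.

Fixpoint tree_decode (t : GenTree.tree unit) : tree :=
  if t is GenTree.Node _ [:: l; r] then Node (tree_decode l) (tree_decode r)
  else Circ.

Lemma tree_encodeK : cancel tree_encode tree_decode.
Proof. by elim=> //= l -> r ->. Qed.

HB.instance Definition _ := Countable.copy tree (can_type tree_encodeK).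

Fixpoint dots (x : tree) : nat :=
  if x is Node l r then (dots l + dots r)%N else 1%N.

Definition degree (x : tree) : nat := (dots x).-1.

Definition Y (n : nat) := {x : tree | degree x == n}.

HB.instance Definition _ (n : nat) := SubCountable.on (Y n).

(** A finite list containing all trees of degree at most [h]. *)
Fixpoint trees_upto (h : nat) : seq tree :=
  if h is h'.+1 then
    Circ :: [seq Node l r | l <- trees_upto h', r <- trees_upto h']
  else [:: Circ].

Lemma dots_gt0 (x : tree) : (0 < dots x)%N.
Proof. by elim: x => //= l Hl r _; rewrite ltn_addr. Qed.

Lemma degree_Node (l r : tree) :
  degree (Node l r) = (degree l + degree r).+1.
Proof.
rewrite /degree /=.
by case: (dots l) (dots_gt0 l) => // a _; case: (dots r) (dots_gt0 r) => // b _;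
  rewrite addnS.
Qed.

Lemma mem_trees_upto (h : nat) (x : tree) :
  (degree x <= h)%N -> x \in trees_upto h.
Proof.
elim: h x => [|h IH] [|l r]; rewrite ?degree_Node //= ltnS => le_h.
rewrite inE /=; apply/allpairsP; exists (l, r); split => //=; apply: IH.
  exact: leq_trans (leq_addr _ _) le_h.
exact: leq_trans (leq_addl _ _) le_h.
Qed.

Definition Y_enum (n : nat) : seq (Y n) :=
  pmap insub (undup (trees_upto n)).

Lemma Y_enumP (n : nat) : Finite.axiom (Y_enum n).
Proof.
apply: Finite.uniq_enumP => [|x].
  by rewrite pmap_sub_uniq // undup_uniq.
rewrite mem_pmap_sub mem_undup mem_trees_upto //.
by rewrite (eqP (valP x)).
Qed.

HB.instance Definition _ (n : nat) := isFinite.Build (Y n) (@Y_enumP n).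

(** * Tamari order *)

(** [rotation y x]: the tree [x] is obtained from [y] by replacing one subtree
    [(a (b c))] by [((a b) c)]. *)
Fixpoint rotation (y x : tree) : bool :=
  match y, x with
  | Node l r, Node l' r' =>
      [|| if r is Node b c then (l' == Node l b) && (r' == c) else false,
          rotation l l' && (r == r')
        | (l == l') && rotation r r']
  | _, _ => false
  end.

Section Tamari.
Variable n : nat.
Implicit Types x y z : Y n.

Definition tamari_le x y : bool :=
  connect (fun u v : Y n => rotation (val u) (val v)) y x.

Definition tamari_lt x y : bool := (x != y) && tamari_le x y.

(** [y] covers [x]. *)
Definition tamari_cover y x : bool :=
  tamari_lt x y && ~~ [exists z, tamari_lt x z && tamari_lt z y].

End Tamari.

(** * Dendriform algebras and the dendriform operad *)

(** Dendriform algebras over the integers: bilinear means biadditive. *)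
Record dendAlgebra := DendAlgebra {
  dend_sort :> zmodType;
  dprec : dend_sort -> dend_sort -> dend_sort;
  dsucc : dend_sort -> dend_sort -> dend_sort;
  dprecDl : left_distributive dprec +%R;
  dprecDr : right_distributive dprec +%R;
  dsuccDl : left_distributive dsucc +%R;
  dsuccDr : right_distributive dsucc +%R;
  dprec_prec : forall a b c,
    dprec (dprec a b) c = dprec a (dprec b c + dsucc b c);
  dsucc_prec : forall a b c,
    dprec (dsucc a b) c = dsucc a (dprec b c);
  dsucc_succ : forall a b c,
    dsucc (dprec a b + dsucc a b) c = dsucc a (dsucc b c)
}.

Section TreeOperation.
Variable A : dendAlgebra.

(** The operation of a tree [x] of degree [m >= 1] on the arguments
    [a 1, ..., a m]; the other values of [a] are irrelevant. By [dsucc_prec],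
    the bracketing of [l > a_k < r] does not matter. The value at [Circ] is a
    dummy. *)
Fixpoint tree_op (x : tree) (a : nat -> A) : A :=
  match x with
  | Circ => 0
  | Node l r =>
      let k := (degree l).+1 in
      let la := if l is Circ then a k else dsucc (tree_op l a) (a k) in
      if r is Circ then la else dprec la (tree_op r (fun j => a (k + j)%N))
  end.

End TreeOperation.

Definition Dend (n : nat) := {ffun Y n -> int}.

HB.instance Definition _ (n : nat) := GRing.Zmodule.on (Dend n).

Definition basis (n : nat) (x : Y n) : Dend n := [ffun y => (y == x)%:R].

Definition dend_op (n : nat) (c : Dend n) (A : dendAlgebra) (a : nat -> A) : A :=
  \sum_(z : Y n) tree_op (val z) a *~ c z.

(** The arguments
    [a_1, ..., a_(i-1), y(a_i, ..., a_(i+n-1)), a_(i+n), a_(i+n+1), ...]. *)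
Definition insert_op (i n : nat) (y : Y n) (A : dendAlgebra) (a : nat -> A)
    (j : nat) : A :=
  if (j < i)%N then a j
  else if j == i then tree_op (val y) (fun k => a (i + k - 1)%N)
  else a (j + n - 1)%N.

Definition is_tree_comp (m n i : nat) (x : Y m) (y : Y n)
    (c : Dend (m + n - 1)) : Prop :=
  forall (A : dendAlgebra) (a : nat -> A),
    dend_op c a = tree_op (val x) (insert_op i y a).

(** Meaningful for [1 <= m], [1 <= n] and [1 <= i <= m], when there is exactly
    one [c] such that [is_tree_comp i x y c]. *)
Definition tree_comp (m n i : nat) (x : Y m) (y : Y n) : Dend (m + n - 1) :=
  xget 0 (is_tree_comp i x y).

Definition dend_comp (m n i : nat) (c : Dend m) (d : Dend n) :
    Dend (m + n - 1) :=
  \sum_(x : Y m) \sum_(y : Y n) tree_comp i x y *~ (c x * d y).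

Definition projective (n : nat) (x : Y n) : Dend n :=
  \sum_(y : Y n | tamari_le y x) basis y.

(** * Quivers and their representations *)

Record quiver := Quiver {
  vertex : Type;
  arrow : vertex -> vertex -> Type
}.

Definition opposite (Q : quiver) : quiver :=
  {| vertex := vertex Q; arrow := fun u v => arrow v u |}.

Inductive prod_arrow (Q R : quiver) :
    vertex Q * vertex R -> vertex Q * vertex R -> Type :=
| ArrowFst (u u' : vertex Q) (v : vertex R) :
    arrow u u' -> prod_arrow (u, v) (u', v)
| ArrowSnd (u : vertex Q) (v v' : vertex R) :
    arrow v v' -> prod_arrow (u, v) (u, v').

Definition prod_quiver (Q R : quiver) : quiver :=
  {| vertex := vertex Q * vertex R; arrow := @prod_arrow Q R |}.

(** Hasse diagram of the Tamari order, oriented decreasingly. *)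
Definition tamari_quiver (n : nat) : quiver :=
  {| vertex := Y n; arrow := fun y x => tamari_cover y x |}.

Inductive qpath (Q : quiver) (u : vertex Q) : vertex Q -> Type :=
| PathNil : qpath u u
| PathRcons (v w : vertex Q) : qpath u v -> arrow v w -> qpath u w.

Record quiver_rep (Q : quiver) := QuiverRep {
  rep_space : vertex Q -> lmodType rat;
  rep_map : forall u v : vertex Q, arrow u v -> {linear rep_space u -> rep_space v}
}.

Section PathAction.
Variables (Q : quiver) (V : quiver_rep Q).

(** The composition of the linear maps along a path. *)
Fixpoint path_action (u v : vertex Q) (p : qpath u v) :
    rep_space V u -> rep_space V v :=
  match p with
  | PathNil => idfun
  | PathRcons _ _ p' e => rep_map V e \o path_action p'
  end.

End PathAction.

Arguments path_action {Q} V {u v} p _.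

(** Any two paths with the same start and the same end act in the same way. *)
Definition all_commuting_relations (Q : quiver) (V : quiver_rep Q) : Prop :=
  forall (u v : vertex Q) (p q : qpath u v), path_action V p =1 path_action V q.

(** * The representation attached to the compositions [P(x) o_1 P(y)] *)

Definition line_or_zero (b : bool) : lmodType rat :=
  if b then (rat^o : lmodType rat) else ('rV[rat]_0 : lmodType rat).

Definition id_or_zero (b c : bool) :
    {linear line_or_zero b -> line_or_zero c} :=
  match b, c with
  | true, true => idfun
  | _, _ => \0
  end.

Definition comp_quiver (m n : nat) : quiver :=
  prod_quiver
    (prod_quiver (opposite (tamari_quiver m)) (opposite (tamari_quiver n)))
    (tamari_quiver (m + n - 1)).

Definition comp_support (m n : nat) (t : Y m * Y n * Y (m + n - 1)) : bool :=
  let: (x, y, z) := t in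
  dend_comp 1 (projective x) (projective y) z != 0.

Definition comp_rep (m n : nat) : quiver_rep (comp_quiver m n) :=
  @QuiverRep (comp_quiver m n)
    (fun t => line_or_zero (comp_support t))
    (fun s t _ => id_or_zero (comp_support s) (comp_support t)).

(* Main.v *)
(** Write [x * y] for [x < y + x > y] in the dendriform sense. The composition
    at the first input only changes the leftmost node of [x]: for
    [x = Node Circ r] and [y = Node s t] it is the sum of the [Node s w] with
    [w] in [t * r], and for other [x] one recurses into the left subtree.
    Since the coefficients are nonnegative, the support of
    [P(x) o_1 P(y)] increases with [x] and [y]. It is also a lower set for the
    Tamari order: a rotation of a tree occurring in [x o_1 y] gives a tree
    occurring in [x' o_1 y'], where [x'] and [y'] are obtained from [x] and [y]
    by at most one rotation each. So the support is closed under all arrows,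
    and every path with supported start acts as the identity.

    That the structure constants are uniquely determined is seen in a
    dendriform algebra of formal series, where the operation of [x] sends the
    generator to the series [x]. *)

Require Import Defs.
From HB Require Import structures.
From mathcomp Require Import all_boot all_order all_algebra.
From mathcomp Require Import classical_sets boolp functions.

Set Implicit Arguments.
Unset Strict Implicit.
Unset Printing Implicit Defensive.

Import Order.TTheory GRing.Theory Num.Theory.
Local Open Scope ring_scope.

(** * Products and compositions of trees *)

(** The terms of [x < y + x > y], with [Circ] acting as the unit. *)
Fixpoint star (x : tree) : tree -> seq tree :=
  fix star_x (y : tree) : seq tree :=
    match x, y with
    | Circ, _ => [:: y]
    | _, Circ => [:: x]
    | Node l r, Node l' r' =>
        [seq Node l w | w <- star r y] ++ [seq Node w r' | w <- star_x l']
    end.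

(** The terms of the composition of [y] at the first input of [x]. *)
Fixpoint comp1 (x y : tree) : seq tree :=
  match x, y with
  | Node Circ r, Node l' r' => [seq Node l' w | w <- star r' r]
  | Node l r, _ => [seq Node w r | w <- comp1 l y]
  | Circ, _ => [::]
  end.

Lemma star_Circl y : star Circ y = [:: y].
Proof. by case: y. Qed.

Lemma star_Circr x : star x Circ = [:: x].
Proof. by case: x. Qed.

Lemma star_Node l r l' r' :
  star (Node l r) (Node l' r') =
  [seq Node l w | w <- star r (Node l' r')] ++
  [seq Node w r' | w <- star (Node l r) l'].
Proof. by []. Qed.

Lemma comp1_Circ r l' r' :
  comp1 (Node Circ r) (Node l' r') = [seq Node l' w | w <- star r' r].
Proof. by []. Qed.

Lemma comp1_Node l r y :
  l != Circ -> comp1 (Node l r) y = [seq Node w r | w <- comp1 l y].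
Proof. by case: l. Qed.

(** Induction along the two recursive calls of [star]: one shrinks the left factor, the other the
    right factor. *)
Lemma star_ind (P : tree -> tree -> Prop) :
  (forall y, P Circ y) -> (forall x, P x Circ) ->
  (forall l r l' r', P r (Node l' r') -> P (Node l r) l' ->
    P (Node l r) (Node l' r')) ->
  forall x y, P x y.
Proof.
move=> PC Pc PN; elim=> [|l _ r IHr] //; elim=> [|l' IHl' r' _] //.
exact: PN.
Qed.

Lemma degree_star x y w : w \in star x y -> degree w = (degree x + degree y)%N.
Proof.
move: x y w; apply: star_ind => [y w|x w|l r l' r' IH1 IH2 w].
- by rewrite star_Circl inE => /eqP->.
- by rewrite star_Circr inE addn0 => /eqP->.
rewrite star_Node mem_cat => /orP[] /mapP[v vin ->]; rewrite !degree_Node.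
  by rewrite (IH1 _ vin) degree_Node !addSn addnA.
by rewrite (IH2 _ vin) degree_Node addnS !addnA.
Qed.

Lemma degree_comp1 x y w :
  y != Circ -> w \in comp1 x y -> degree w = (degree x + degree y - 1)%N.
Proof.
move=> yN; elim: x w => [|l IHl r _] w //.
have [->|lN] := eqVneq l Circ.
  case: y yN {IHl} => // l' r' _; rewrite comp1_Circ => /mapP[v /degree_star E ->].
  by rewrite !degree_Node E addSn subSS subn0 add0n addnS addnA addnC.
rewrite comp1_Node // => /mapP[v vin ->]; rewrite !degree_Node (IHl _ vin).
case: l lN {IHl vin} => // l1 l2 _; rewrite degree_Node.
by rewrite !addSn !subSS !subn0 addnAC.
Qed.

Lemma comp1_neq_Circ x y w : w \in comp1 x y -> w != Circ.
Proof. case: x => [|l r] //; have [->|lN] := eqVneq l Circ.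
  by case: y => [|l' r'] //; rewrite comp1_Circ => /mapP[? _ ->].
by rewrite comp1_Node // => /mapP[? _ ->]. Qed.

(** * Tree operations in a dendriform algebra *)

Section TreeOperations.
Variable A : dendAlgebra.
Implicit Types (a b : nat -> A) (x y : tree) (s : seq tree).

Lemma eq_tree_op x a b :
  (forall j, (0 < j)%N -> a j = b j) -> tree_op x a = tree_op x b.
Proof.
elim: x a b => //= l IHl r IHr a b ab.
rewrite (IHl _ _ ab) ab // (IHr _ (fun j => b ((degree l).+1 + j)%N)) // => j _.
exact: ab.
Qed.

Lemma dprec0r (u : A) : dprec u 0 = 0.
Proof. by apply: (addrI (dprec u 0)); rewrite -dprecDr !addr0. Qed.
Lemma dprec0l (u : A) : dprec 0 u = 0.
Proof. by apply: (addrI (dprec 0 u)); rewrite -dprecDl !addr0. Qed.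
Lemma dsucc0l (u : A) : dsucc 0 u = 0.
Proof. by apply: (addrI (dsucc 0 u)); rewrite -dsuccDl !addr0. Qed.

Lemma dprec_suml s (F : tree -> A) u :
  dprec (\sum_(w <- s) F w) u = \sum_(w <- s) dprec (F w) u.
Proof. by rewrite (big_morph (fun v => dprec v u) (fun v w => dprecDl v w u) (dprec0l u)). Qed.
Lemma dprec_sumr s (F : tree -> A) u :
  dprec u (\sum_(w <- s) F w) = \sum_(w <- s) dprec u (F w).
Proof. by rewrite (big_morph (fun v => dprec u v) (dprecDr u) (dprec0r u)). Qed.
Lemma dsucc_suml s (F : tree -> A) u :
  dsucc (\sum_(w <- s) F w) u = \sum_(w <- s) dsucc (F w) u.
Proof. by rewrite (big_morph (fun v => dsucc v u) (fun v w => dsuccDl v w u) (dsucc0l u)). Qed.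

(** The factor [l > a_k] of the operation of [Node l r]. It does not depend on [r], so the dot cases
    of [l] and of [r] can be treated separately. *)
Definition left_op (l : tree) a : A :=
  if l is Circ then a (degree l).+1 else dsucc (tree_op l a) (a (degree l).+1).

Lemma tree_op_left l a : tree_op (Node l Circ) a = left_op l a.
Proof. by []. Qed.

Lemma tree_op_Node l r a : r != Circ ->
  tree_op (Node l r) a =
  dprec (left_op l a) (tree_op r (fun j => a ((degree l).+1 + j)%N)).
Proof. by case: r. Qed.

Lemma left_op_Node l a : l != Circ ->
  left_op l a = dsucc (tree_op l a) (a (degree l).+1).
Proof. by case: l. Qed.

Lemma star_neq_Circl x y w : x != Circ -> w \in star x y -> w != Circ.
Proof.
case: x => // l r _ /degree_star; rewrite degree_Node => E.
by apply/eqP => wC; rewrite wC in E.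
Qed.

Lemma star_neq_Circr x y w : y != Circ -> w \in star x y -> w != Circ.
Proof.
case: y => // l r _ /degree_star; rewrite degree_Node addnS => E.
by apply/eqP => wC; rewrite wC in E.
Qed.

(** The two halves of the recursion for [star] mirror the axioms: [dprec_prec] pushes a [<] product
    into the right subtree of the first factor, [dsucc_succ] pushes a [>] product into the left
    subtree of the second. *)
Lemma tree_op_star l r l' r' a :
  dprec (tree_op (Node l r) a)
      (tree_op (Node l' r') (fun j => a (degree (Node l r) + j)%N)) =
    \sum_(w <- star r (Node l' r')) tree_op (Node l w) a /\
  dsucc (tree_op (Node l r) a)
      (tree_op (Node l' r') (fun j => a (degree (Node l r) + j)%N)) =
    \sum_(w <- star (Node l r) l') tree_op (Node w r') a.
Proof.
(* The axioms call for the sum of both products of smaller trees, which is [P]; the induction runs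
   on the finer [Q], and adding its two halves gives [P]. *)
pose P x y := x != Circ -> y != Circ -> forall a,
  dprec (tree_op x a) (tree_op y (fun j => a (degree x + j)%N)) +
  dsucc (tree_op x a) (tree_op y (fun j => a (degree x + j)%N)) =
  \sum_(w <- star x y) tree_op w a.
pose Q x y := forall l r l' r', x = Node l r -> y = Node l' r' -> forall a,
  dprec (tree_op x a) (tree_op y (fun j => a (degree x + j)%N)) =
    \sum_(w <- star r y) tree_op (Node l w) a /\
  dsucc (tree_op x a) (tree_op y (fun j => a (degree x + j)%N)) =
    \sum_(w <- star x l') tree_op (Node w r') a.
have QP x y : Q x y -> P x y.
  case: x => // l1 r1; case: y => // l2 r2 H _ _ b.
  have [-> ->] := H _ _ _ _ erefl erefl b.
  by rewrite star_Node big_cat !big_map.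
suff: Q (Node l r) (Node l' r') by move/(_ _ _ _ _ erefl erefl a).
move: (Node l r) (Node l' r') => x y {l r l' r' a}.
move: x y; apply: star_ind => // l r l' r' IH1 IH2 _ _ _ _ [<- <-] [<- <-] a.
set y := Node l' r' in IH1 *; have yN : y != Circ by [].
set x := Node l r in IH2 *; have xN : x != Circ by [].
split.
  have [rC|rN] := eqVneq r Circ.
    by rewrite /x rC star_Circl big_seq1 tree_op_left tree_op_Node // degree_Node addn0.
  rewrite {1}/x tree_op_Node // dprec_prec.
  have := QP _ _ IH1 rN yN (fun j => a ((degree l).+1 + j)%N).
  have E : tree_op y (fun j => a (degree x + j)%N) =
      tree_op y (fun j => a ((degree l).+1 + (degree r + j))%N).
    by apply: eq_tree_op => j _; rewrite degree_Node addnA addSn.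
  rewrite E => ->; rewrite dprec_sumr big_seq [RHS]big_seq.
  by apply: eq_bigr => w /(star_neq_Circr yN) wN; rewrite tree_op_Node.
(* First the [>] product without the right subtree [r']; afterwards [dsucc_prec] lets [r'] be
   attached from outside. *)
have L : dsucc (tree_op x a) (left_op l' (fun j => a (degree x + j)%N)) =
    \sum_(w <- star x l') left_op w a.
  have [->|lN] := eqVneq l' Circ.
    by rewrite star_Circr big_seq1 (left_op_Node _ xN) /left_op addn1.
  rewrite left_op_Node // -dsucc_succ (QP _ _ IH2 xN lN) dsucc_suml.
  rewrite big_seq [RHS]big_seq; apply: eq_bigr => w win.
  by rewrite left_op_Node ?(star_neq_Circl _ win) // (degree_star win) addnS.
have [rC|rN] := eqVneq r' Circ.
  by rewrite /y rC tree_op_left L.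
rewrite {1}/y tree_op_Node // -dsucc_prec L dprec_suml.
rewrite big_seq [RHS]big_seq; apply: eq_bigr => w win.
rewrite tree_op_Node // (degree_star win); congr dprec.
by apply: eq_tree_op => j _; rewrite -addnS addnA.
Qed.

(** At the leftmost node of [x], the inserted operation is the first argument, so its product with
    the right subtree is the [<] half of [tree_op_star]. Higher nodes are handled by induction on
    the left subtree. *)
Lemma tree_op_comp1 x n (y : Y n) a : val y != Circ -> x != Circ ->
  tree_op x (insert_op 1 y a) = \sum_(w <- comp1 x (val y)) tree_op w a.
Proof.
case: y => y /= degy yN.
elim: x => // l IHl r _ _.
have [->|lN] := eqVneq l Circ.
  have insR : tree_op r (fun j => insert_op 1 (exist _ y degy) a (1 + j)%N) =
      tree_op r (fun j => a (degree y + j)%N).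
    apply: eq_tree_op => -[|j] // _; rewrite add1n /insert_op /=.
    by rewrite (eqP degy) addSn subn1 addnC.
  have ins1 : insert_op 1 (exist _ y degy) a 1 = tree_op y a.
    by apply: eq_tree_op => j _; rewrite add1n subn1.
  case: y yN {IHl} degy insR ins1 => // l' r' _ degy insR ins1.
  rewrite comp1_Circ big_map.
  have [->|rN] := eqVneq r Circ.
    by rewrite star_Circr big_seq1 tree_op_left.
  rewrite tree_op_Node // insR [left_op _ _]ins1.
  by case: r rN {insR} => // l2 r2 _; have [-> _] := tree_op_star l' r' l2 r2 a.
have degl : (0 < degree l)%N by case: (l) lN => // *; rewrite degree_Node.
rewrite comp1_Node // big_map.
(* Arguments beyond the inserted one are shifted by [degree y - 1]; since [degree l] and [j] are
   positive, the index here is at least 2. *)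
have insE j : (0 < j)%N -> insert_op 1 (exist _ y degy) a (degree l + j)%N =
    a (degree l + degree y - 1 + j)%N.
  case: (degree l) degl => // d _; case: j => // j _.
  rewrite !(addSn, addnS) /insert_op /= (eqP degy).
  by rewrite !addSn !subn1 /= addnAC.
have L : left_op l (insert_op 1 (exist _ y degy) a) =
    \sum_(w <- comp1 l y) left_op w a.
  rewrite left_op_Node // IHl // dsucc_suml big_seq [RHS]big_seq.
  apply: eq_bigr => w win; rewrite left_op_Node ?(comp1_neq_Circ win) //.
  by rewrite (degree_comp1 yN win) -(addn1 (degree l)) insE // addn1.
have [->|rN] := eqVneq r Circ; first by rewrite tree_op_left L.
rewrite tree_op_Node // L dprec_suml big_seq [RHS]big_seq.
apply: eq_bigr => w win; rewrite tree_op_Node // (degree_comp1 yN win).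
by congr dprec; apply: eq_tree_op => j _; rewrite addSnnS insE // addSnnS.
Qed.

End TreeOperations.

(** Brings sums over lists of trees into the shape of [dend_op], multiplicities becoming
    coefficients. *)
Lemma sum_count_Y (A : zmodType) n (s : seq tree) (F : tree -> A) :
  (forall w, w \in s -> degree w = n) ->
  \sum_(w <- s) F w = \sum_(z : Y n) F (val z) *~ (count_mem (val z) s)%:Z.
Proof.
elim: s => [|w s IH] degs; first by rewrite big_nil big1.
rewrite big_cons IH => [|v vin]; last by apply: degs; rewrite inE vin orbT.
have degw : degree w == n by rewrite degs ?mem_head.
rewrite [RHS](eq_bigr (fun z : Y n => F (val z) *~ (w == val z)%:Z +
    F (val z) *~ (count_mem (val z) s)%:Z)) => [|z _]; last first.
  by rewrite -mulrzDr -PoszD.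
rewrite big_split /=; congr (_ + _).
rewrite (bigD1 (Sub w degw)) //= eqxx big1 ?addr0 // => z zw.
by rewrite eq_sym -[w]/(val (Sub w degw : Y n)) val_eqE (negPf zw).
Qed.

(** * The dendriform algebra of formal series of trees *)

(** The coefficient of [z] in the product of the series [a] and [b], where
    [Circ] acts as the unit. *)
Fixpoint series_mul (a b : tree -> int) (z : tree) : int :=
  if z is Node l r then
    series_mul (fun w => a (Node l w)) b r + series_mul a (fun w => b (Node w r)) l
  else a Circ * b Circ.

(** Removing the coefficient of the unit [Circ] makes the dendriform axioms hold on all functions
    [tree -> int], with no need for a subtype. *)
Definition series_aug (a : tree -> int) (z : tree) : int :=
  if z is Circ then 0 else a z.

Definition series_prec (a b : tree -> int) (z : tree) : int :=
  if z is Node l r then series_mul (fun w => a (Node l w)) (series_aug b) r else 0.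

Definition series_succ (a b : tree -> int) (z : tree) : int :=
  if z is Node l r then series_mul (series_aug a) (fun w => b (Node w r)) l else 0.

Lemma series_mulDl a a' b z :
  series_mul (fun w => a w + a' w) b z = series_mul a b z + series_mul a' b z.
Proof.
elim: z a a' b => [|l IHl r IHr] a a' b /=; first exact: mulrDl.
by rewrite IHr IHl addrACA.
Qed.

Lemma series_mulDr a b b' z :
  series_mul a (fun w => b w + b' w) z = series_mul a b z + series_mul a b' z.
Proof.
elim: z a b b' => [|l IHl r IHr] a b b' /=; first exact: mulrDr.
by rewrite IHr IHl addrACA.
Qed.

Lemma series_mulZl k a b z :
  series_mul (fun w => k * a w) b z = k * series_mul a b z.
Proof.
elim: z a b => [|l IHl r IHr] a b /=; first by rewrite mulrA.
by rewrite IHr IHl mulrDr.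
Qed.

Lemma series_mulZr k a b z :
  series_mul a (fun w => b w * k) z = series_mul a b z * k.
Proof.
elim: z a b => [|l IHl r IHr] a b /=; first by rewrite mulrA.
by rewrite IHr IHl mulrDl.
Qed.

(* [series_mul a f l] is linear in the values of [f], and likewise on the right. *)
Lemma series_mul_exchange a (b : tree -> tree -> int) c l r :
  series_mul (fun w => series_mul a (b^~ w) l) c r =
  series_mul a (fun u => series_mul (b u) c r) l.
Proof.
elim: l a b => [|l1 IH1 l2 IH2] a b /=; first exact: series_mulZl.
by rewrite series_mulDl IH2 IH1.
Qed.

(** At [Node l r] both sides split into three terms, according to whether the root comes from [a],
    [b] or [c]; the middle one is [series_mul_exchange]. *)
Lemma series_mulA a b c z :
  series_mul (series_mul a b) c z = series_mul a (series_mul b c) z.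
Proof.
elim: z a b c => [|l IHl r IHr] a b c; first by rewrite /= mulrA.
rewrite /= (series_mulDl (series_mul (fun w => a (Node l w)) b)) series_mulDr.
by rewrite IHr IHl series_mul_exchange addrA.
Qed.

(** Reduces the first and third dendriform axioms to associativity of [series_mul]. *)
Lemma series_aug_mul b c :
  series_aug (series_prec b c + series_succ b c) =
  series_mul (series_aug b) (series_aug c).
Proof. by apply/funext => -[|l r] //=; rewrite mul0r. Qed.

Lemma series_augD a b : series_aug (a + b) = series_aug a + series_aug b.
Proof. by apply/funext => -[|l r] //=; rewrite -[RHS]/(_ + _) addr0. Qed.

Lemma series_precDl : left_distributive series_prec +%R.
Proof.
move=> a b c; apply/funext => -[|l r]; first by rewrite -[RHS]/(0 + 0) addr0.
exact: series_mulDl.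
Qed.

Lemma series_precDr : right_distributive series_prec +%R.
Proof.
move=> a b c; apply/funext => -[|l r]; first by rewrite -[RHS]/(0 + 0) addr0.
by rewrite /= series_augD; apply: series_mulDr.
Qed.

Lemma series_succDl : left_distributive series_succ +%R.
Proof.
move=> a b c; apply/funext => -[|l r]; first by rewrite -[RHS]/(0 + 0) addr0.
by rewrite /= series_augD; apply: series_mulDl.
Qed.

Lemma series_succDr : right_distributive series_succ +%R.
Proof.
move=> a b c; apply/funext => -[|l r]; first by rewrite -[RHS]/(0 + 0) addr0.
exact: series_mulDr.
Qed.

Lemma series_prec_prec a b c :
  series_prec (series_prec a b) c =
  series_prec a (series_prec b c + series_succ b c).
Proof.
by apply/funext => -[|l r] //=; rewrite series_aug_mul; apply: series_mulA.
Qed.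

Lemma series_succ_prec a b c :
  series_prec (series_succ a b) c = series_succ a (series_prec b c).
Proof.
apply/funext => -[|l r] //=.
exact: (series_mul_exchange _ (fun u w => b (Node u w))).
Qed.

Lemma series_succ_succ a b c :
  series_succ (series_prec a b + series_succ a b) c =
  series_succ a (series_succ b c).
Proof.
by apply/funext => -[|l r] //=; rewrite series_aug_mul; apply: series_mulA.
Qed.

Definition series_dend : dendAlgebra :=
  DendAlgebra series_precDl series_precDr series_succDl series_succDr
    series_prec_prec series_succ_prec series_succ_succ.

Definition tree_series (x z : tree) : int := (z == x)%:R.

Lemma series_mul0l b z : series_mul (fun=> 0) b z = 0.
Proof. by rewrite (series_mulZl 0 (fun=> 0)) mul0r. Qed.

Lemma series_mul0r a z : series_mul a (fun=> 0) z = 0.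
Proof. by rewrite (series_mulZr 0 a (fun=> 0)) mulr0. Qed.

Lemma series_mul1l b z : series_mul (tree_series Circ) b z = b z.
Proof.
elim: z b => [|l IHl r _] b /=; first by rewrite mul1r.
by rewrite series_mul0l add0r IHl.
Qed.

Lemma series_mul1r a z : series_mul a (tree_series Circ) z = a z.
Proof.
elim: z a => [|l _ r IHr] a /=; first by rewrite mulr1.
by rewrite series_mul0r addr0 IHr.
Qed.

Lemma tree_series_Node l r p q :
  tree_series (Node l r) (Node p q) = tree_series l p * tree_series r q.
Proof.
rewrite /tree_series -natrM mulnb; congr (nat_of_bool _)%:R.
by apply/eqP/andP => [[-> ->]|[/eqP-> /eqP->]].
Qed.

Lemma series_aug_tree x : x != Circ -> series_aug (tree_series x) = tree_series x.
Proof. by case: x => // l r _; apply/funext => -[]. Qed.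

Lemma tree_op_series x : x != Circ ->
  @tree_op series_dend x (fun=> tree_series (Node Circ Circ)) = tree_series x.
Proof.
elim: x => // l IHl r IHr _.
have L : @left_op series_dend l (fun=> tree_series (Node Circ Circ)) =
    tree_series (Node l Circ).
  have [->|lN] := eqVneq l Circ; first by [].
  rewrite left_op_Node // IHl //; apply/funext => -[|p q] //=.
  rewrite series_aug_tree //.
  (* The indicator of a node factors over its subtrees: one factor comes out as a scalar, the other
     is the unit of [series_mul]. *)
  under [fun w => tree_series _ (Node w q)]funext => w do rewrite tree_series_Node.
  by rewrite series_mulZr series_mul1r tree_series_Node.
have [->|rN] := eqVneq r Circ; first by rewrite tree_op_left.
rewrite tree_op_Node // L IHr //; apply/funext => -[|p q] //=.
rewrite series_aug_tree //.
under [fun w => tree_series _ (Node p w)]funext => w do rewrite tree_series_Node.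
by rewrite series_mulZl series_mul1l tree_series_Node.
Qed.

(** * Structure constants of the composition *)

Lemma Y_neq_Circ n (x : Y n) : (0 < n)%N -> val x != Circ.
Proof. by case: x => -[|l r] //= /eqP <-. Qed.

Lemma fct_mulrzE (T : Type) (V : zmodType) (f : T -> V) (k : int) t :
  (f *~ k) t = f t *~ k.
Proof.
have natE i : (f *+ i) t = f t *+ i.
  by elim: i => // i IH; rewrite !mulrS -IH.
by case: k => i //=; [exact: natE | rewrite -[RHS]/(- (f t *+ i.+1)) -natE].
Qed.

Lemma dend_op_series n (c : Dend n) (z : Y n) : (0 < n)%N ->
  @dend_op n c series_dend (fun=> tree_series (Node Circ Circ)) (val z) = c z.
Proof.
move=> n0; have -> : @dend_op n c series_dend (fun=> tree_series (Node Circ Circ)) =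
    \sum_(w : Y n) ((tree_series (val w) *~ c w) : tree -> int).
  by apply: eq_bigr => w _; rewrite tree_op_series ?Y_neq_Circ.
rewrite fct_sumE (bigD1 z) //= big1 => [|w wz]; rewrite fct_mulrzE /tree_series.
  by rewrite eqxx addr0 intz.
by rewrite (inj_eq val_inj) eq_sym (negPf wz) mul0rz.
Qed.

(** Counting the terms of [comp1] gives one solution of [is_tree_comp], so the chosen [tree_comp] is
    a solution too; evaluation at the generator of the series algebra shows that they agree. *)
Lemma tree_comp_count m n (x : Y m) (y : Y n) z : (0 < m)%N -> (0 < n)%N ->
  tree_comp 1 x y z = (count_mem (val z) (comp1 (val x) (val y)))%:Z.
Proof.
move=> m0 n0.
have [xN yN] := (Y_neq_Circ x m0, Y_neq_Circ y n0).
pose c : Dend (m + n - 1) :=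
  [ffun z => (count_mem (val z) (comp1 (val x) (val y)))%:Z].
have cP : is_tree_comp 1 x y c.
  move=> A a; rewrite tree_op_comp1 // (@sum_count_Y _ (m + n - 1)) => [|w win].
    by apply: eq_bigr => w _; rewrite ffunE.
  by rewrite (degree_comp1 yN win) (eqP (valP x)) (eqP (valP y)).
have N0 : (0 < m + n - 1)%N by case: (m) (n) m0 n0 => [|?] [|?] // *; rewrite addSn subn1 addnS.
have tP : is_tree_comp 1 x y (tree_comp 1 x y) by apply: xgetPex; exists c.
by rewrite -(dend_op_series (tree_comp 1 x y) z N0) tP -cP dend_op_series // ffunE.
Qed.

Lemma projectiveE n (x y : Y n) : projective x y = (tamari_le y x)%:R.
Proof.
rewrite /projective sum_ffunE; have [yx|nyx] := boolP (tamari_le y x).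
  rewrite (bigD1 y) //= ffunE eqxx big1 ?addr0 // => w /andP[_ wy].
  by rewrite ffunE eq_sym (negPf wy).
rewrite big1 // => w wx; rewrite ffunE; case: eqP => // yw.
by rewrite yw wx in nyx.
Qed.

(** No cancellation can occur among natural numbers, so a nonzero coefficient is witnessed by a
    single pair of trees. *)
Lemma comp_supportP m n (x : Y m) (y : Y n) z : (0 < m)%N -> (0 < n)%N ->
  reflect (exists x1 y1, [/\ tamari_le x1 x, tamari_le y1 y &
                             val z \in comp1 (val x1) (val y1)])
          (comp_support (x, y, z)).
Proof.
move=> m0 n0; rewrite /comp_support /dend_comp sum_ffunE.
pose F x1 y1 : int := (count_mem (val z) (comp1 (val x1) (val y1)) *
  (tamari_le x1 x * tamari_le y1 y))%N.
have F0 x1 y1 : 0 <= F x1 y1 by [].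
rewrite (eq_bigr (fun x1 => \sum_y1 F x1 y1)) => [|x1 _]; last first.
  rewrite sum_ffunE; apply: eq_bigr => y1 _.
  rewrite !projectiveE -natrM.
  have -> (d : Dend (m + n - 1)) (k : int) : (d *~ k) z = d z *~ k.
    case: k => i /=; first by rewrite ffunMnE.
    by rewrite !NegzE !mulrNz ffunE ffunMnE.
  by rewrite tree_comp_count // -mulrzr intz /F PoszM natz.
rewrite psumr_neq0 => [|x1 _]; last exact: sumr_ge0.
apply: (iffP hasP) => [[x1 _]|[x1 [y1 [x1x y1y zin]]]] /=.
  rewrite lt0r psumr_neq0 // => /andP[/hasP[y1 _ /=]] + _.
  rewrite ltz_nat !muln_gt0 -has_count has_pred1 !lt0b => /and3P[zin x1x y1y].
  by exists x1, y1.
exists x1; first exact: mem_index_enum.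
rewrite lt0r sumr_ge0 // andbT psumr_neq0 //; apply/hasP.
exists y1; first exact: mem_index_enum.
by rewrite ltz_nat !muln_gt0 -has_count has_pred1 !lt0b zin x1x.
Qed.

(** * Rotations *)

Lemma rotation_inv l r t : rotation (Node l r) t ->
  [\/ exists b c, r = Node b c /\ t = Node (Node l b) c,
      exists2 l', rotation l l' & t = Node l' r |
      exists2 r', rotation r r' & t = Node l r'].
Proof.
case: t => // l' r' /= /or3P[|/andP[ll /eqP->]|/andP[/eqP<- rr]].
- by case: r => // b c /andP[/eqP-> /eqP->]; constructor 1; exists b, c.
- by constructor 2; exists l'.
by constructor 3; exists r'.
Qed.

Lemma rotation_root a b c : rotation (Node a (Node b c)) (Node (Node a b) c).
Proof. by rewrite /= !eqxx. Qed.

Lemma rotation_l l l' r : rotation l l' -> rotation (Node l r) (Node l' r).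
Proof. by move=> /= ->; rewrite eqxx orbT. Qed.

Lemma rotation_r l r r' : rotation r r' -> rotation (Node l r) (Node l r').
Proof. by move=> /= ->; rewrite eqxx !orbT. Qed.

Lemma degree_rotation x y : rotation x y -> degree y = degree x.
Proof.
elim: x y => // l IHl r IHr y /rotation_inv[[b [c [-> ->]]]|[l' /IHl E ->]|[r' /IHr E ->]].
- by rewrite !degree_Node addSn addnS addnA.
- by rewrite !degree_Node E.
by rewrite !degree_Node E.
Qed.

(** Needed because a rotation of a term of a product may leave a factor unchanged. *)
Definition rotation_eq x y := (x == y) || rotation x y.

Lemma rotation_eqxx x : rotation_eq x x.
Proof. by rewrite /rotation_eq eqxx. Qed.

Lemma rotation_eqW x y : rotation x y -> rotation_eq x y.
Proof. by rewrite /rotation_eq => ->; rewrite orbT. Qed.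

Lemma rotation_eq_l l l' r : rotation_eq l l' -> rotation_eq (Node l r) (Node l' r).
Proof. by case/orP=> [/eqP->|/rotation_l H]; [exact: rotation_eqxx | exact: rotation_eqW]. Qed.

Lemma rotation_eq_r l r r' : rotation_eq r r' -> rotation_eq (Node l r) (Node l r').
Proof. by case/orP=> [/eqP->|/rotation_r H]; [exact: rotation_eqxx | exact: rotation_eqW]. Qed.

(** * Rotations of the terms of a product *)

Lemma mem_star_l l r y w : w \in star r y -> Node l w \in star (Node l r) y.
Proof.
case: y => [|l' r'] win; first by move: win; rewrite star_Circr inE => /eqP->; rewrite inE.
by rewrite star_Node mem_cat map_f.
Qed.

Lemma mem_star_r x l r w : w \in star x l -> Node w r \in star x (Node l r).
Proof.
case: x => [|l' r'] win; first by move: win; rewrite star_Circl inE => /eqP->; rewrite inE.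
by rewrite star_Node mem_cat orbC map_f.
Qed.

Lemma mem_star_Node l r y w : w \in star (Node l r) y ->
  (exists2 v, v \in star r y & w = Node l v) \/
  (exists l' r' v, [/\ y = Node l' r', v \in star (Node l r) l' & w = Node v r']).
Proof.
case: y => [|l' r'].
  by rewrite star_Circr inE => /eqP->; left; exists r; rewrite // star_Circr inE.
rewrite star_Node mem_cat => /orP[] /mapP[v vin ->]; first by left; exists v.
by right; exists l', r', v.
Qed.

Lemma star_rotation x y w w' : w \in star x y -> rotation w w' ->
  exists x' y', [/\ rotation_eq x x', rotation_eq y y' & w' \in star x' y'].
Proof.
move: x y w w'; apply: star_ind => [y w w'|x w w'|l r l' r' IH1 IH2 w w'].
- rewrite star_Circl inE => /eqP-> /rotation_eqW yw; exists Circ, w'.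
  by rewrite yw star_Circl inE.
- rewrite star_Circr inE => /eqP-> /rotation_eqW xw; exists w', Circ.
  by rewrite xw star_Circr inE.
set x := Node l r in IH2 *; set y := Node l' r' in IH1 *.
rewrite star_Node mem_cat => /orP[] /mapP[v vin ->] {w}.
  case/rotation_inv=> [[b [c [vE ->]]]|[l2 ll ->]|[v' vv ->]].
  (* Rotation at the root. If the root of [v] comes from [y], the rotated tree is already a term of
     [star x y]; if it comes from [r], rotate [x] at its root. *)
  - case: r vin @x IH1 IH2 => [|r1 r2] vin x IH1 IH2.
      move: vin; rewrite star_Circl vE inE => /eqP[-> ->].
      exists x, y; rewrite !rotation_eqxx; split=> //.
      by apply: mem_star_r; apply: mem_star_l; rewrite star_Circl inE.
    have [[w win]|[l2 [r3 [w [[<- <-] win]]]]] := mem_star_Node vin; rewrite vE => -[-> ->].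
      exists (Node (Node l r1) r2), y.
      by rewrite rotation_eqxx rotation_eqW ?rotation_root //; split=> //; apply: mem_star_l.
    exists x, y; rewrite !rotation_eqxx; split=> //.
    by apply: mem_star_r; apply: mem_star_l.
  - exists (Node l2 r), y; rewrite rotation_eqxx rotation_eqW ?rotation_l //.
    by split=> //; apply: mem_star_l.
  have [r2 [y2 [rr yy win]]] := IH1 _ _ vin vv.
  by exists (Node l r2), y2; split=> //; [exact: rotation_eq_r | exact: mem_star_l].
case/rotation_inv=> [[b [c [rE ->]]]|[v' vv ->]|[r2 rr ->]].
- exists x, (Node (Node l' b) c); rewrite rotation_eqxx /y rE.
  rewrite rotation_eqW ?rotation_root //; split=> //.
  by do 2!apply: mem_star_r.
- have [x2 [l2 [xx ll win]]] := IH2 _ _ vin vv.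
  by exists x2, (Node l2 r'); split=> //; [exact: rotation_eq_l | exact: mem_star_r].
exists x, (Node l' r2); rewrite rotation_eqxx rotation_eqW ?rotation_r //.
by split=> //; apply: mem_star_r.
Qed.

(** * Rotations of the terms of a composition *)

Lemma mem_comp1_Circ r l' r' w :
  w \in star r' r -> Node l' w \in comp1 (Node Circ r) (Node l' r').
Proof. by move=> win; rewrite comp1_Circ map_f. Qed.

Lemma mem_comp1_Node l r y w :
  l != Circ -> w \in comp1 l y -> Node w r \in comp1 (Node l r) y.
Proof. by move=> lN win; rewrite comp1_Node // map_f. Qed.

Lemma rotation_eq_neq_Circ x x' : x != Circ -> rotation_eq x x' -> x' != Circ.
Proof. by case: x => // l r _ /orP[/eqP<-|/rotation_inv[[? [? [_ ->]]]|[? _ ->]|[? _ ->]]]. Qed.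

Lemma comp1_rotation x y w w' : y != Circ -> w \in comp1 x y -> rotation w w' ->
  exists x' y', [/\ rotation_eq x x', rotation_eq y y' & w' \in comp1 x' y'].
Proof.
move=> yN; elim: x w w' => [|l IHl r _] w w' //.
have [->|lN] := eqVneq l Circ.
  case: y yN {IHl} => // s t _; set y := Node s t; set x := Node Circ r.
  rewrite comp1_Circ => /mapP[v vin ->] {w}.
  case/rotation_inv=> [[p [q [vE ->]]]|[s' ss ->]|[v' vv ->]].
  (* Rotation at the root. If the root of [v] comes from [t], rotate [y]; if it comes from [r],
     rotate [x], which moves its first input one level deeper. *)
  - case: t vin @y => [|t1 t2] vin y.
      move: vin; rewrite star_Circl vE inE => /eqP rE.
      exists (Node (Node Circ p) q), y; rewrite rotation_eqxx.
      rewrite rotation_eqW /x -?rE ?rotation_root //; split=> //.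
      apply: mem_comp1_Node => //; apply: mem_comp1_Circ.
      by rewrite star_Circl inE.
    have [[w win]|[r1 [r2 [w [rE win]]]]] := mem_star_Node vin; rewrite vE => -[-> ->].
      exists x, (Node (Node s t1) t2); rewrite rotation_eqxx.
      by rewrite rotation_eqW ?rotation_root //; split=> //; apply: mem_comp1_Circ.
    exists (Node (Node Circ r1) r2), y; rewrite rotation_eqxx.
    rewrite rotation_eqW /x ?rE ?rotation_root //; split=> //.
    by apply: mem_comp1_Node => //; apply: mem_comp1_Circ.
  - exists x, (Node s' t); rewrite rotation_eqxx rotation_eqW ?rotation_l //.
    by split=> //; apply: mem_comp1_Circ.
  have [t' [r' [tt rr win]]] := star_rotation vin vv.
  exists (Node Circ r'), (Node s t').
  by split; [exact: rotation_eq_r | exact: rotation_eq_r | exact: mem_comp1_Circ].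
rewrite comp1_Node // => /mapP[v vin ->] {w}.
case/rotation_inv=> [[p [q [rE ->]]]|[v' vv ->]|[r' rr ->]].
(* The root and its right subtree belong to [x], so the same rotation is available in [x]. *)
- exists (Node (Node l p) q), y; rewrite rotation_eqxx rE.
  rewrite rotation_eqW ?rotation_root //; split=> //.
  by do 2!apply: mem_comp1_Node => //.
- have [l' [y' [ll yy win]]] := IHl _ _ vin vv.
  exists (Node l' r), y'; split=> //; first exact: rotation_eq_l.
  by apply: mem_comp1_Node win; apply: rotation_eq_neq_Circ ll.
exists (Node l r'), y; rewrite rotation_eqxx rotation_eqW ?rotation_r //.
by split=> //; apply: mem_comp1_Node.
Qed.

(** * The support is closed along arrows *)

Lemma tamari_le_trans n (x y z : Y n) :
  tamari_le x y -> tamari_le y z -> tamari_le x z.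
Proof. by move=> xy yz; apply: connect_trans yz xy. Qed.

Lemma rotation_eq_lift n (x : Y n) t : rotation_eq (val x) t ->
  exists2 x' : Y n, val x' = t & tamari_le x' x.
Proof.
case/orP=> [/eqP<-|xt]; first by exists x => //; apply: connect0.
have degt : degree t == n by rewrite (degree_rotation xt) (valP x).
by exists (Sub t degt) => //; apply: connect1.
Qed.

Lemma connect_closed (T : finType) (e : rel T) (P : T -> Prop) u v :
  (forall s t, e s t -> P s -> P t) -> connect e u v -> P u -> P v.
Proof.
move=> eP /connectP[p + ->]; elim: p u => //= w p IH u /andP[uw wp] Pu.
exact: IH wp (eP _ _ uw Pu).
Qed.

Lemma comp_support_le m n (x x' : Y m) (y y' : Y n) z z' :
    (0 < m)%N -> (0 < n)%N ->
    tamari_le x x' -> tamari_le y y' -> tamari_le z' z ->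
  comp_support (x, y, z) -> comp_support (x', y', z').
Proof.
move=> m0 n0 xx yy zz /(comp_supportP _ _ _ m0 n0)[x1 [y1 [x1x y1y zin]]].
have : comp_support (x', y', z).
  apply/comp_supportP=> //; exists x1, y1; split=> //.
    exact: tamari_le_trans xx.
  exact: tamari_le_trans yy.
(* A chain of rotations leads from [z] to [z'], so a single rotation suffices; the factors it may
   rotate stay below [x'] and [y']. *)
apply: (connect_closed (P := fun w => comp_support (x', y', w))) zz => u v uv.
case/(comp_supportP _ _ _ m0 n0)=> [x3 [y3 [x3x y3y uin]]].
have [tx [ty [/rotation_eq_lift[x2 <- x2x3] /rotation_eq_lift[y2 <- y2y3] vin]]] :=
  comp1_rotation (Y_neq_Circ y3 n0) uin uv.
apply/comp_supportP=> //; exists x2, y2; split=> //.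
  exact: tamari_le_trans x3x.
exact: tamari_le_trans y3y.
Qed.

Lemma tamari_cover_le n (y x : Y n) : tamari_cover y x -> tamari_le x y.
Proof. by case/andP=> /andP[]. Qed.

(** Arrows raise [x] or [y], because of the opposite quivers, or lower [z]: the directions in which
    the support is closed. *)
Lemma comp_support_arrow m n (s t : vertex (comp_quiver m n)) :
  (0 < m)%N -> (0 < n)%N -> arrow s t -> comp_support s -> comp_support t.
Proof.
move=> m0 n0; have le_refl k (w : Y k) : tamari_le w w by apply: connect0.
case=> [_ _ z [x x' y|x y y']|[x y] z z'] /tamari_cover_le le;
  exact: comp_support_le.
Qed.

Lemma id_or_zero_id b (v : line_or_zero b) : id_or_zero b b v = v.
Proof. by case: b v => //= v; rewrite [v]thinmx0. Qed.

(** The composite fails to be the direct map only for line, zero, line, which [b -> c] excludes. *)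
Lemma id_or_zero_comp (b c d : bool) (v : line_or_zero b) :
  (b -> c) -> id_or_zero c d (id_or_zero b c v) = id_or_zero b d v.
Proof.
by case: b c d v => [] [] [] //= v bc; rewrite ?linear0 //; have := bc isT.
Qed.

Theorem proposition8p1 (m n : nat) (hm : (1 <= m)%N) (hn : (1 <= n)%N) :
  all_commuting_relations (comp_rep m n).
Proof.
(* The action of a path is determined by its endpoints alone. *)
suff pathE (u v : vertex (comp_quiver m n)) (p : qpath u v) a :
    path_action (comp_rep m n) p a =
    id_or_zero (comp_support u) (comp_support v) a.
  by move=> u v p q a; rewrite !pathE.
elim: p a => [|w t p IH e] a /=; first by rewrite id_or_zero_id.
rewrite IH; apply: id_or_zero_comp.
by elim: p {IH e} => // w1 w2 p IH e /IH; apply: comp_support_arrow.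
Qed.
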